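(* Let $d\ge1$, $\lambda>0$, and let $f_0:\mathbb{R}^d\to[0,\infty)$ be a probability density such that: (i) $f_0$ is continuous and $\lim_{\|x\|\to\infty}f_0(x)=0$; (ii) there are constants $C,\bar\epsilon>0$ with $\int_{\{x:|f_0(x)-\lambda|\le\epsilon\}}f_0(x)\,dx\le C\epsilon$ for all $\epsilon\in(0,\bar\epsilon)$; (iii) for any $\lambda_l<\lambda_h$ in $[\lambda-\bar\epsilon,\lambda+\bar\epsilon]$ and $x,y\in S_{\lambda_h}$, if $x,y$ are disconnected in $S_{\lambda_h}$ then they are disconnected in $S_{\lambda_l}$, and if $x,y$ are connected in $S_{\lambda_l}$ then they are connected in $S_{\lambda_h}$. Let $\mathcal{X}_n=\{x_1,\dots,x_n\}$ be drawn independently from $f_0$ with $n\ge16$, and let $D=\binom n2^{-1}L$ with $L$ the Inactive/Active Binder loss with constants $0<a\le1$, $0<m\le1$, $a\le2m$. Then with probability at least $1-\frac{n+1}{n^2}$, for every $\epsilon\in(0,\bar\epsilon/2)$, $$\sup_{\delta\in[r_{n,\lambda,d},\,2h(\epsilon)]}\ \sup_{f:\|f-f_0\|_\infty\le\epsilon} D\{\tilde\psi_{\lambda,\delta}(f),\psi_\lambda(f_0)\}\le 8\Big(C\epsilon+\sqrt{\tfrac{\ln n}{n}}\Big),$$ where $r_{n,\lambda,d}=2\big(\frac{16\,d\ln n}{\lambda v_d n}\big)^{1/d}$ and $h(\eta)=\max\{h\ge0:\sup_{\|x-y\|\le h}|f_0(x)-f_0(y)|\le\eta\}$.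
   Context: $S_t=\{x\in\mathbb{R}^d:f_0(x)\ge t\}$; connectivity is topological. $v_d$ is the volume of the unit Euclidean ball in $\mathbb{R}^d$. A sub-partition of $\mathcal{X}_n$ is a collection of non-empty pairwise disjoint subsets of $\mathcal{X}_n$ (union possibly proper); its union is the active set, other points are inactive; its allocation vector $c$ has $c_i=h$ if $x_i\in C_h$, $c_i=0$ if inactive. $\psi_\lambda(f_0)$ is the sub-partition of $\mathcal{X}_n$ formed by the non-empty sets $W\cap\mathcal{X}_n$ with $W$ a connected component of $S_\lambda$. For $f:\mathbb{R}^d\to\mathbb{R}$ and $\delta>0$, $\tilde\psi_{\lambda,\delta}(f)$ is the sub-partition given by the graph-theoretic connected components of the graph with vertices $\{x\in\mathcal{X}_n:f(x)\ge\lambda\}$ and edges between $x,y$ with $\|x-y\|<\delta$. The Inactive/Active Binder loss between sub-partitions with active sets $A,A'$, inactive sets $I,I'$ and allocation vectors $c,c'$ is $L=(n-1)m(|A\cap I'|+|I\cap A'|)+\sum_{i<j,\,x_i,x_j\in A\cap A'}a[\mathbf 1(c_i=c_j,c'_i\ne c'_j)+\mathbf 1(c_i\ne c_j,c'_i=c'_j)]$. *)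

(* Defs.v *)
From HB Require Import structures.
From mathcomp Require Import all_boot all_order all_algebra.
From mathcomp Require Import all_classical all_reals all_analysis.
From Stdlib Require Import Relation_Operators.
Set Implicit Arguments. Unset Strict Implicit. Unset Printing Implicit Defensive.
Import Order.TTheory GRing.Theory Num.Theory.
Import numFieldNormedType.Exports.
Local Open Scope classical_set_scope.
Local Open Scope ring_scope.

(* Points of R^d are row vectors 'rV[R]_d (product topology = Euclidean topology). *)

Definition enorm (R : realType) (d : nat) (x : 'rV[R]_d) : R :=
  Num.sqrt (\sum_(i < d) x ord0 i ^+ 2).

Definition Rd (R : realType) (d : nat) := g_sigma_algebraType (@open 'rV[R]_d).

(* [leb] is the Lebesgue measure on the Borel sets of R^d: the measure giving
   every closed box its volume (this characterizes it uniquely). *)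
Definition is_lebesgue (R : realType) (d : nat)
    (leb : {measure set (Rd R d) -> \bar R}) : Prop :=
  forall a b : 'rV[R]_d, (forall i, a ord0 i <= b ord0 i) ->
    leb [set x : Rd R d | forall i, a ord0 i <= x ord0 i <= b ord0 i]
    = (\prod_(i < d) (b ord0 i - a ord0 i))%:E.

Definition vol_unit_ball (R : realType) (d : nat)
    (leb : {measure set (Rd R d) -> \bar R}) : R :=
  fine (leb [set x : Rd R d | enorm x < 1]).

Definition Slev (R : realType) (d : nat) (f0 : 'rV[R]_d -> R) (t : R)
  : set 'rV[R]_d := [set x | t <= f0 x].

(* h(eta) = max {h >= 0 : sup_{|x-y| <= h} |f0 x - f0 y| <= eta}, taken in the
   extended reals (it is +oo if the set is unbounded) *)
Definition hmod (R : realType) (d : nat) (f0 : 'rV[R]_d -> R) (eta : R) : \bar R :=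
  ereal_sup [set h%:E | h in [set h : R | 0 <= h /\
      forall x y : 'rV[R]_d, enorm (x - y) <= h -> `|f0 x - f0 y| <= eta]].

(* A sub-partition of the sample {x_1,...,x_n} (indexed by 'I_n) is encoded by
   the relation "x_i and x_j lie in the same block" (a partial equivalence
   relation); x_i is active iff it is related to itself.  With allocation
   vector c, for active i,j: rel i j <-> c_i = c_j. *)

Definition psi_true (R : realType) (d n : nat) (f0 : 'rV[R]_d -> R) (lam : R)
    (x : 'I_n -> 'rV[R]_d) : 'I_n -> 'I_n -> Prop :=
  fun i j => connected_component (Slev f0 lam) (x i) (x j).

Definition psi_graph (R : realType) (d n : nat) (f : 'rV[R]_d -> R) (lam delta : R)
    (x : 'I_n -> 'rV[R]_d) : 'I_n -> 'I_n -> Prop :=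
  fun i j => lam <= f (x i) /\
    clos_refl_trans 'I_n
      (fun k l => [/\ lam <= f (x k), lam <= f (x l) & enorm (x k - x l) < delta])
      i j.

Definition IAB_loss (R : realType) (n : nat) (a m : R)
    (c1 c2 : 'I_n -> 'I_n -> Prop) : R :=
  (n.-1)%:R * m *
    (#|[set i : 'I_n | `[< c1 i i /\ ~ c2 i i >] ]|
     + #|[set i : 'I_n | `[< ~ c1 i i /\ c2 i i >] ]|)%:R
  + \sum_(i < n) \sum_(j < n | (i < j)%N &&
        `[< [/\ c1 i i, c1 j j, c2 i i & c2 j j] >])
      a * ((`[< c1 i j /\ ~ c2 i j >] : nat)%:R + (`[< ~ c1 i j /\ c2 i j >] : nat)%:R).

Definition IAB_D (R : realType) (n : nat) (a m : R)
    (c1 c2 : 'I_n -> 'I_n -> Prop) : R :=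
  IAB_loss a m c1 c2 / ('C(n, 2))%:R.

Definition rnld (R : realType) (d n : nat) (lam vd : R) : R :=
  2 * powR (16 * d%:R * ln n%:R / (lam * vd * n%:R)) (d%:R^-1).

(* Main.v *)
Require Import Defs.
From HB Require Import structures.
From mathcomp Require Import all_boot all_order all_algebra.
From mathcomp Require Import all_classical all_reals all_analysis.
From mathcomp Require Import ring lra zify.
From Stdlib Require Import Relation_Operators.
Import Order.TTheory GRing.Theory Num.Theory.
Import numFieldNormedType.Exports.
Local Open Scope classical_set_scope.
Local Open Scope ring_scope.

(* Level sets near lam have stable connectivity, so on a good event only sample
   points in the band {|f0 - lam| <= 2 eps} can be misclassified, and
   D <= 2 * (fraction of sample points in that band).

   Write rho = r_(n,lam,d) / 2.  A graph path moves by steps < delta <= 2 h(eps), so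
   the segments it follows stay in S_(lam - 2 eps), and two sample points of S_lam
   joined by the graph are connected in S_lam.  Conversely a connected subset of
   S_(lam + 2 eps) is covered by the rho-balls around active sample points, as soon
   as every rho-ball inside S_lam contains a sample point; overlapping balls give
   edges, so connectedness puts all of them in one component of the graph.

   A rho-ball inside S_lam has mass at least 16 d ln n / n.  Taking a maximal
   rho/(2d)-separated set of centres of such balls (at most n^(d+1) of them) and
   shrinking the radius by rho/(2d), which costs a factor at most 2 in mass, all
   of them are hit with probability at least 1 - 1/n^2.  Chernoff's bound over a
   grid of n band widths controls the fraction of sample points in every band
   with probability at least 1 - 1/n. *)

Set Implicit Arguments. Unset Strict Implicit. Unset Printing Implicit Defensive.

Section Euclid.
Context {R : realType} {d : nat}.
Implicit Types (x y z : 'rV[R]_d) (r c : R).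

Definition eball z r : set 'rV[R]_d := [set x | enorm (x - z) < r].

Lemma enorm_ge0 x : 0 <= enorm x.
Proof. exact: sqrtr_ge0. Qed.

Lemma sqr_enorm x : enorm x ^+ 2 = \sum_(i < d) x ord0 i ^+ 2.
Proof. by rewrite sqr_sqrtr// sumr_ge0// => i _; exact: sqr_ge0. Qed.

Lemma enorm0 : enorm (0 : 'rV[R]_d) = 0.
Proof. by rewrite /enorm big1 ?sqrtr0// => i _; rewrite mxE expr0n. Qed.

Lemma enormZ c x : enorm (c *: x) = `|c| * enorm x.
Proof.
rewrite /enorm -sqrtr_sqr -sqrtrM ?sqr_ge0//; congr Num.sqrt.
by rewrite mulr_sumr; apply: eq_bigr => i _; rewrite mxE exprMn.
Qed.

Lemma enorm_distC x y : enorm (x - y) = enorm (y - x).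
Proof. by rewrite -opprB -scaleN1r enormZ normrN1 mul1r. Qed.

Lemma normr_coord_le x i : `|x ord0 i| <= enorm x.
Proof.
rewrite -(ler_pXn2r (_ : 0 < 2)%N)// ?nnegrE ?enorm_ge0//.
rewrite sqr_enorm real_normK ?num_real// (bigD1 i)//= lerDl.
by apply: sumr_ge0 => j _; exact: sqr_ge0.
Qed.

Lemma dot_le_enorm x y :
  \sum_(i < d) x ord0 i * y ord0 i <= enorm x * enorm y.
Proof.
have [x0|x0] := eqVneq (enorm x) 0.
  rewrite big1 ?x0 ?mul0r// => i _.
  have := normr_coord_le x i; rewrite x0 normr_le0 => /eqP ->.
  by rewrite mul0r.
have [y0|y0] := eqVneq (enorm y) 0.
  rewrite big1 ?y0 ?mulr0// => i _.
  have := normr_coord_le y i; rewrite y0 normr_le0 => /eqP ->.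
  by rewrite mulr0.
have xp : 0 < enorm x by rewrite lt_def x0 enorm_ge0.
have yp : 0 < enorm y by rewrite lt_def y0 enorm_ge0.
have : 0 <= \sum_(i < d) (enorm y * x ord0 i - enorm x * y ord0 i) ^+ 2.
  by apply: sumr_ge0 => i _; exact: sqr_ge0.
have -> : \sum_(i < d) (enorm y * x ord0 i - enorm x * y ord0 i) ^+ 2 =
    enorm y ^+ 2 * \sum_(i < d) x ord0 i ^+ 2
    - 2 * (enorm x * enorm y) * (\sum_(i < d) x ord0 i * y ord0 i)
    + enorm x ^+ 2 * \sum_(i < d) y ord0 i ^+ 2.
  rewrite !mulr_sumr -sumrB -big_split/=; apply: eq_bigr => i _; ring.
rewrite -!sqr_enorm.
set S := \sum_(i < d) _; set u := enorm x in xp *; set v := enorm y in yp *.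
move=> h; rewrite -(ler_pM2l (mulr_gt0 xp yp)).
by rewrite -(ler_pM2l (_ : 0 < 2 :> R))//; lra.
Qed.

Lemma ler_enormD x y : enorm (x + y) <= enorm x + enorm y.
Proof.
rewrite -(ler_pXn2r (_ : 0 < 2)%N)// ?nnegrE ?addr_ge0 ?enorm_ge0//.
rewrite sqr_enorm sqrrD !sqr_enorm.
under eq_bigr do rewrite mxE sqrrD.
by rewrite !big_split/= lerD2r lerD2l mulr2n lerD// dot_le_enorm.
Qed.

Lemma ler_enorm_dist z x y : enorm (x - y) <= enorm (x - z) + enorm (z - y).
Proof. by rewrite -(subrKA z); exact: ler_enormD. Qed.

Lemma continuous_enorm : continuous (@enorm R d).
Proof.
move=> x; apply: (@continuous_comp _ _ _
   (fun x : 'rV[R]_d => \sum_(i < d) x ord0 i ^+ 2)); last exact: sqrt_continuous.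
apply: continuous_big => /= [|i _ y]; first exact: add_continuous.
apply: (@continuous_comp _ _ _ (fun x : 'rV[R]_d => x ord0 i)
  (fun t : R => t ^+ 2)).
  exact: coord_continuous.
exact: exprn_continuous.
Qed.

Lemma open_eball z r : open (eball z r).
Proof.
apply: (@open_comp _ _ (fun x => enorm (x - z)) [set t | t < r]); last exact: open_lt.
move=> x _; apply: (@continuous_comp _ _ _ (fun x => x - z)).
  by apply: (@continuousB _ _ _ id (cst z)) => //; exact: cst_continuous.
exact: continuous_enorm.
Qed.

Lemma connected_segment x y :
  connected [set x + t *: (y - x) | t in `[0, 1]%classic].
Proof.
apply: connected_continuous_connected; first exact: segment_connected.
apply: continuous_subspaceT => t.
by apply: cvgD; [exact: cvg_cst|exact: scalel_continuous].
Qed.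

End Euclid.

Section LebesgueBoxes.
Context {R : realType} {d : nat}.
Implicit Types (a b x y z : 'rV[R]_d) (r : R).

Definition cbox a b : set (Rd R d) :=
  [set x : Rd R d | forall i, a ord0 i <= x ord0 i <= b ord0 i].

Definition cboxes : set (set (Rd R d)) := [set B | exists a b, B = cbox a b].

Lemma open_borel (A : set 'rV[R]_d) : open A -> measurable (A : set (Rd R d)).
Proof. exact: sub_sigma_algebra. Qed.

Lemma measurable_eball z r : measurable (eball z r : set (Rd R d)).
Proof. by apply: open_borel; exact: open_eball. Qed.

Lemma closed_cbox a b : closed (cbox a b : set 'rV[R]_d).
Proof.
have -> : (cbox a b : set 'rV[R]_d) =
    \bigcap_i ((fun x => x ord0 i) @^-1` [set t | a ord0 i <= t <= b ord0 i]).
  by apply/seteqP; split => x /= h i; [move=> _; exact: h|exact: (h i)].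
apply: closed_bigI => i _; apply: closed_comp => [x _|].
  exact: coord_continuous.
have := closedI (@closed_ge R (a ord0 i)) (@closed_le R (b ord0 i)).
by congr closed; apply/seteqP; split => t /=; [move=> [-> ->]|move=> /andP[]].
Qed.

Lemma rational_cbox_nbhs (U : set 'rV[R]_d) x : open U -> U x ->
  exists pq : 'rV[rat]_d * 'rV[rat]_d,
    cbox (map_mx ratr pq.1) (map_mx ratr pq.2) x /\
    cbox (map_mx ratr pq.1) (map_mx ratr pq.2) `<=` U.
Proof.
move=> oU Ux.
have /nbhs_ballP[e /= e0 eU] : nbhs x U by exact: open_nbhs_nbhs.
have qlt i : {q | ratr q \in `]x ord0 i - e, x ord0 i[}.
  by apply/cid/rat_in_itvoo; rewrite ltrBlDr ltrDl.
have qgt i : {q | ratr q \in `]x ord0 i, x ord0 i + e[}.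
  by apply/cid/rat_in_itvoo; rewrite ltrDl.
exists (\row_i sval (qlt i), \row_i sval (qgt i)) => /=; split.
  move=> i; rewrite !mxE.
  have := svalP (qlt i); have := svalP (qgt i); rewrite !in_itv/=.
  by move=> /andP[/ltW -> _] /andP[_ /ltW ->].
move=> y xy; apply: eU; split => // i j; rewrite (ord1 i).
have := xy j; rewrite !mxE.
have := svalP (qlt j); have := svalP (qgt j); rewrite !in_itv/=.
move=> /andP[_ h1] /andP[h2 _] /andP[h3 h4].
by rewrite /ball/= ltr_distl; apply/andP; split; lra.
Qed.

Lemma borel_cboxesE : @measurable _ (Rd R d) = <<s cboxes >>.
Proof.
apply/seteqP; split; apply: smallest_sub.
- exact: smallest_sigma_algebra.
- move=> U oU.
  pose F (pq : 'rV[rat]_d * 'rV[rat]_d) : set (Rd R d) :=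
    let B := cbox (map_mx ratr pq.1) (map_mx ratr pq.2) in
    [set x | B x /\ B `<=` U].
  have -> : (U : set (Rd R d)) = \bigcup_pq F pq.
    apply/seteqP; split => [x Ux|x [pq _ [Bx]]]; last exact.
    by have [pq ?] := rational_cbox_nbhs oU Ux; exists pq.
  apply: (@countable_bigcupT_measurable _ (g_sigma_algebraType cboxes)).
    exact: countableP.
  move=> pq; rewrite /F.
  have [h|h] := pselect (cbox (map_mx ratr pq.1) (map_mx ratr pq.2) `<=` U).
    apply: sub_sigma_algebra; exists (map_mx ratr pq.1), (map_mx ratr pq.2).
    by apply/seteqP; split => [x []//|x ?]; split.
  rewrite (_ : [set x | _] = set0); first exact: measurable0.
  by apply/seteqP; split => // x [].
- exact: sigma_algebra_measurable.
- move=> _ [a [b ->]]; rewrite -(setCK (cbox a b)); apply: measurableC.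
  by apply: open_borel; rewrite openC; exact: closed_cbox.
Qed.

Lemma setI_closed_cboxes : setI_closed cboxes.
Proof.
move=> _ _ [a1 [b1 ->]] [a2 [b2 ->]].
exists (\row_i Num.max (a1 ord0 i) (a2 ord0 i)),
  (\row_i Num.min (b1 ord0 i) (b2 ord0 i)).
apply/seteqP; split => [x [h1 h2] i|x h]; last split => i.
- by rewrite !mxE ge_max le_min; move: (h1 i) (h2 i) => /andP[-> ->] /andP[-> ->].
- by have := h i; rewrite !mxE ge_max le_min => /andP[/andP[-> _] /andP[-> _]].
- by have := h i; rewrite !mxE ge_max le_min => /andP[/andP[_ ->] /andP[_ ->]].
Qed.

Lemma bigcup_cboxT :
  \bigcup_k cbox (const_mx (- k%:R)) (const_mx k%:R) = [set: Rd R d].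
Proof.
apply/seteqP; split => // x _.
exists (Num.truncn (enorm (x : 'rV[R]_d))).+1 => //= i; rewrite !mxE -ler_norml.
apply: le_trans (normr_coord_le _ _) _; apply/ltW.
exact: truncnS_gt.
Qed.

Lemma affine_continuous c z : continuous (fun x : 'rV[R]_d => c *: (x - z)).
Proof.
move=> x; apply: (@continuous_comp _ _ _ (fun x => x - z) (fun x => c *: x)).
  by apply: (@continuousB _ _ _ id (cst z)) => //; exact: cst_continuous.
exact: scaler_continuous.
Qed.

Lemma continuous_borel_fun (T : 'rV[R]_d -> 'rV[R]_d) : continuous T ->
  measurable_fun setT (T : Rd R d -> Rd R d).
Proof.
move=> cT.
apply: (@measurability _ _ (Rd R d) (Rd R d) setT T (@open 'rV[R]_d)) => //.
move=> _ [U oU <-]; rewrite setTI.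
by apply: open_borel; apply: (@open_comp _ _ T) => // x _; exact: cT.
Qed.

Context (leb : {measure set (Rd R d) -> \bar R}).
Hypothesis hleb : is_lebesgue leb.

Lemma lebesgue_cbox_affine r z a b : 0 < r ->
  leb ((fun x : 'rV[R]_d => r^-1 *: (x - z)) @^-1` cbox a b) =
  ((r ^+ d)%:E * leb (cbox a b))%E.
Proof.
move=> r0.
have [ab|nab] := pselect (forall i, a ord0 i <= b ord0 i); last first.
  have cb0 : cbox a b = set0.
    apply/seteqP; split => // x h; apply: nab => i.
    by have /andP[] := h i; exact: le_trans.
  by rewrite cb0 preimage_set0 measure0 mule0.
rewrite /cbox hleb// -EFinM.
have -> : (fun x : 'rV[R]_d => r^-1 *: (x - z)) @^-1` cbox a b =
    cbox (z + r *: a) (z + r *: b).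
  apply/seteqP; split => x /= h i; have := h i; rewrite !mxE.
    rewrite ler_pdivlMl// ler_pdivrMl// => /andP[h1 h2].
    by apply/andP; split; lra.
  by move=> /andP[h1 h2]; rewrite ler_pdivlMl// ler_pdivrMl//; apply/andP; split; lra.
rewrite /cbox hleb => [|i]; last by rewrite !mxE lerD2l ler_pM2l.
congr _%:E; rewrite -[d in r ^+ d]card_ord -prodr_const -big_split/=.
by apply: eq_bigr => i _; rewrite !mxE; ring.
Qed.

Lemma lebesgue_affine r z (E : set (Rd R d)) : 0 < r -> measurable E ->
  leb ((fun x : 'rV[R]_d => r^-1 *: (x - z)) @^-1` E) = ((r ^+ d)%:E * leb E)%E.
Proof.
move=> r0 mE.
have mT := continuous_borel_fun (@affine_continuous r^-1 z).
have rd0 : 0 <= r ^+ d by rewrite exprn_ge0// ltW.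
pose m1 := measure_function_pushforward__canonical__measure_function_Measure leb mT.
pose m2 := measure_function_mscale__canonical__measure_function_Measure (NngNum rd0) leb.
have := @measure_unique _ _ _ cboxes
  (fun k => cbox (const_mx (- k%:R)) (const_mx k%:R)) borel_cboxesE
  setI_closed_cboxes _ bigcup_cboxT m1 m2.
rewrite /m1 /m2 /= /pushforward /mscale /=; apply => //.
- by move=> k; exists (const_mx (- k%:R)), (const_mx k%:R).
- by move=> _ [a [b ->]]; exact: lebesgue_cbox_affine.
- move=> k; rewrite lebesgue_cbox_affine// /cbox hleb; last first.
    by move=> i; rewrite !mxE; apply: (@le_trans _ _ 0); rewrite ?oppr_le0 ?ler0n.
  by rewrite -EFinM ltry.
Qed.

Lemma lebesgue_eball r z : 0 < r ->
  leb (eball z r) = ((r ^+ d)%:E * leb [set x : Rd R d | (enorm (x : 'rV[R]_d) < 1)%R])%E.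
Proof.
move=> r0; rewrite -(@lebesgue_affine r z _ r0); last first.
  by have := open_borel (@open_eball R d 0 1); congr measurable;
    apply/seteqP; split => x; rewrite /eball/= subr0.
congr (leb _); apply/seteqP; split => x; rewrite /eball/=;
  by rewrite enormZ gtr0_norm ?invr_gt0// ltr_pdivrMl// mulr1.
Qed.

Lemma vol_unit_ballE :
  (vol_unit_ball leb)%:E = leb [set x : Rd R d | (enorm (x : 'rV[R]_d) < 1)%R].
Proof.
rewrite /vol_unit_ball fineK// ge0_fin_numE//.
apply: (@le_lt_trans _ _ (leb (cbox (const_mx (-1)) (const_mx 1)))).
  apply: le_measure; rewrite ?inE.
  - by have := open_borel (@open_eball R d 0 1); congr measurable;
      apply/seteqP; split => x; rewrite /eball/= subr0.
  - by rewrite borel_cboxesE; apply: sub_sigma_algebra; do 2 eexists.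
  - move=> x /= x1 i; rewrite !mxE -ler_norml.
    by apply: le_trans (normr_coord_le _ _) _; exact: ltW.
rewrite /cbox hleb ?ltry// => i; rewrite !mxE; lra.
Qed.

Lemma vol_unit_ball_gt0 : 0 < vol_unit_ball leb.
Proof.
rewrite -lte_fin vol_unit_ballE.
pose c : R := d.+1%:R^-1.
have c0 : 0 < c by rewrite invr_gt0 ltr0n.
apply: (@lt_le_trans _ _ (leb (cbox (const_mx (-c)) (const_mx c)))).
  rewrite /cbox hleb => [|i]; last by rewrite !mxE; lra.
  by rewrite lte_fin prodr_gt0// => i _; rewrite !mxE; lra.
apply: le_measure; rewrite ?inE.
- by rewrite borel_cboxesE; apply: sub_sigma_algebra; do 2 eexists.
- by have := open_borel (@open_eball R d 0 1); congr measurable;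
    apply/seteqP; split => x; rewrite /eball/= subr0.
- move=> x /= xc; rewrite -(ltr_pXn2r (_ : 0 < 2)%N)// ?nnegrE ?enorm_ge0//.
  rewrite sqr_enorm expr1n.
  apply: (@le_lt_trans _ _ (\sum_(i < d) c)).
    apply: ler_sum => i _; rewrite -real_normK ?num_real//.
    have xi : `|x ord0 i| <= c by have := xc i; rewrite !mxE -ler_norml.
    have c1 : c <= 1 by rewrite invf_le1 ?ltr0n// ler1n.
    rewrite expr2; apply: le_trans (ler_pM _ _ xi xi) _ => //.
    by rewrite ler_piMl// ltW.
  rewrite sumr_const card_ord -mulr_natl /c ltr_pdivrMr ?ltr0n// mul1r.
  by rewrite ltr_nat.
Qed.

End LebesgueBoxes.

Section FiniteUnionBound.
Context {dT : measure_display} {T : measurableType dT} {R : realType}.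
Context (mu : {measure set T -> \bar R}).

Lemma measure_bigsetU_le (I : Type) (r : seq I) (Q : pred I) (F : I -> set T) :
  (forall i, measurable (F i)) ->
  (mu (\big[setU/set0]_(i <- r | Q i) F i) <= \sum_(i <- r | Q i) mu (F i))%E.
Proof.
move=> mF; elim: r => [|i r IH]; first by rewrite !big_nil measure0.
rewrite !big_cons; case: ifP => // _.
apply: (@le_trans _ _ (mu (F i) + mu (\big[setU/set0]_(i <- r | Q i) F i))%E).
  by apply: measureU2 => //; apply: bigsetU_measurable => j _.
exact: leeD.
Qed.

End FiniteUnionBound.

Lemma expR1_le3 (R : realType) : expR 1 <= 3 :> R.
Proof.
have h : 5 / 6 <= expR (- (1 / 6)) :> R.
  by apply: le_trans (expR_ge1Dx _); lra.
have -> : expR 1 = expR (1 / 6) ^+ 6 :> R.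
  by rewrite -expRM_natl; congr expR; lra.
have h2 : expR (1 / 6) <= 6 / 5 :> R.
  have h3 : expR (1 / 6) * (5 / 6) <= expR (1 / 6) * expR (- (1 / 6)) :> R.
    by rewrite ler_wpM2l ?expR_ge0.
  by move: h3; rewrite -expRD subrr expR0; lra.
apply: (@le_trans _ _ ((6 / 5) ^+ 6)).
  by rewrite lerXn2r// ?nnegrE ?expR_ge0//; lra.
lra.
Qed.

Section Samples.
Context {dO dT : measure_display} {Omega : measurableType dO}
  {T : measurableType dT} {R : realType} (P : probability Omega R)
  {n : nat} (X : 'I_n -> Omega -> T).
Hypothesis mX : forall i, measurable_fun [set: Omega] (X i).
Hypothesis indepX : forall B : 'I_n -> set T, (forall i, measurable (B i)) ->
  P (\bigcap_(i in [set: 'I_n]) (X i @^-1` B i)) =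
  (\prod_(i < n) P (X i @^-1` B i))%E.

Lemma measurable_sample_preimage i (B : set T) : measurable B ->
  measurable (X i @^-1` B).
Proof. by move=> mB; rewrite -[X in measurable X]setTI; exact: mX. Qed.

Definition hits (B : set T) (w : Omega) : {set 'I_n} :=
  [set i | `[< B (X i w) >]].

Definition hit_pattern (B : set T) (J : {set 'I_n}) : set Omega :=
  \bigcap_(i in [set: 'I_n]) (X i @^-1` (if i \in J then B else ~` B)).

Lemma hit_patternE B J : hit_pattern B J = [set w | hits B w = J].
Proof.
apply/seteqP; split => w /=.
  move=> h; apply/setP => i; rewrite inE; have := h i Logic.I.
  rewrite /preimage/=; case: ifP => _ hi; first exact/asboolT.
  exact/asboolF.
by move=> <- i _; rewrite inE /preimage/=; case: asboolP.
Qed.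

Lemma measurable_hit_pattern B J : measurable B -> measurable (hit_pattern B J).
Proof.
move=> mB; apply: fin_bigcap_measurable => // i _.
by apply: measurable_sample_preimage; case: ifP => // _; exact: measurableC.
Qed.

Variables (B : set T) (p : R).
Hypothesis mB : measurable B.
Hypothesis probB : forall i, P (X i @^-1` B) = p%:E.

Lemma prob_hit_pattern J :
  P (hit_pattern B J) = (\prod_(i < n) (if i \in J then p else 1 - p))%:E.
Proof.
rewrite /hit_pattern indepX => [|i]; last first.
  by case: ifP => // _; exact: measurableC.
rewrite -prodEFin; apply: eq_bigr => i _; case: ifP => // _.
rewrite preimage_setC probability_setC ?probB//.
exact: measurable_sample_preimage.
Qed.

Lemma prob_no_hit : P [set w | hits B w = finset.set0] = ((1 - p) ^+ n)%:E.
Proof.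
rewrite -hit_patternE prob_hit_pattern.
under eq_bigr do rewrite inE.
by rewrite prodr_const card_ord.
Qed.

Hypothesis p01 : 0 <= p <= 1.

(* Chernoff's bound with exponent 1, using e - 1 <= 2. *)
Lemma prob_hits_gt (t : R) :
  measurable [set w | (t < #|hits B w|%:R)%R] /\
  (P [set w | (t < #|hits B w|%:R)%R] <= (expR (2 * n%:R * p - t)%R)%:E)%E.
Proof.
have -> : [set w | (t < #|hits B w|%:R)%R] =
    \big[setU/set0]_(J : {set 'I_n} | t < #|J|%:R) hit_pattern B J.
  rewrite -bigcup_seq_cond; apply/seteqP; split => w /=.
    by move=> h; exists (hits B w); rewrite ?hit_patternE//= mem_index_enum.
  by move=> [J /= /andP[_ h]]; rewrite hit_patternE /= => ->.
split.
  by apply: bigsetU_measurable => J _; exact: measurable_hit_pattern.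
apply: (@le_trans _ _
    (\sum_(J : {set 'I_n} | (t < #|J|%:R)%R) P (hit_pattern B J))%E).
  by apply: measure_bigsetU_le => J; exact: measurable_hit_pattern.
under eq_bigr do rewrite prob_hit_pattern.
rewrite sumEFin lee_fin; have /andP[p0 p1] := p01.
pose e1 : R := expR 1.
have w0 J : 0 <= \prod_(i < n) (if i \in (J : {set 'I_n}) then p else 1 - p).
  by apply: prodr_ge0 => i _; case: ifP; lra.
have we J : (\prod_(i < n) (if i \in (J : {set 'I_n}) then p else 1 - p)) *
    expR #|J|%:R =
    \prod_(i < n) (if i \in J then p * e1 else 1 - p).
  rewrite -[#|J|%:R]mulr1 expRM_natl -/e1 -prodr_const [X in _ * X]big_mkcond/=.
  by rewrite -big_split/=; apply: eq_bigr => i _; case: ifP => _; rewrite ?mulr1.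
apply: (@le_trans _ _ (\sum_(J : {set 'I_n})
    (\prod_(i < n) (if i \in J then p * e1 else 1 - p)) * expR (- t))).
  rewrite big_mkcond/=; apply: ler_sum => J _; case: ifPn => [tJ|_].
    by rewrite -we -mulrA -expRD ler_peMr ?w0// -[leLHS]expR0 ler_expR subr_ge0 ltW.
  by rewrite -we !mulr_ge0 ?expR_ge0 ?w0.
rewrite -mulr_suml -bigA_distr/= prodr_const card_ord expRD ler_wpM2r ?expR_ge0//.
rewrite -mulrA mulrCA expRM_natl lerXn2r ?nnegrE ?expR_ge0//.
  by rewrite addr_ge0 ?mulr_ge0 ?expR_ge0//; lra.
apply: le_trans (expR_ge1Dx _).
have : p * e1 <= p * 3 by rewrite ler_wpM2l// expR1_le3.
lra.
Qed.

End Samples.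

Section Loss.
Context {R : realType} {n : nat}.
Implicit Types (c : 'I_n -> 'I_n -> Prop) (W : {set 'I_n}) (a m : R).

Lemma sum_lt_pairs W :
  \sum_(i < n) \sum_(j < n | (i < j)%N) ((i \in W)%:R + (j \in W)%:R) =
  (n.-1)%:R * #|W|%:R :> R.
Proof.
under eq_bigr do rewrite big_split/=.
rewrite big_split/= [X in _ + X](exchange_big_dep predT)//= -big_split/=.
transitivity (\sum_(i < n) (n.-1)%:R * (i \in W)%:R : R).
  apply: eq_bigr => i _.
  have -> : \sum_(j < n | (j < i)%N) (i \in W)%:R =
     \sum_(j < n | (i != j) && ~~ (i < j)%N) (i \in W)%:R :> R.
    by apply: eq_bigl => j; rewrite -leqNgt ltn_neqAle eq_sym.
  have -> : \sum_(j < n | (i < j)%N) (i \in W)%:R =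
     \sum_(j < n | (i != j) && (i < j)%N) (i \in W)%:R :> R.
    by apply: eq_bigl => j; rewrite andb_idl// ltn_neqAle => /andP[].
  rewrite -bigID sumr_const -[LHS]mulr_natl; congr (_%:R * _).
  have := cardC1 i; rewrite card_ord => <-.
  by apply: eq_card => j; rewrite !inE eq_sym.
by rewrite -mulr_sumr -natr_sum -big_mkcond/= sum1_card.
Qed.

Lemma bin2_natr : ('C(n, 2))%:R * 2 = n%:R * (n.-1)%:R :> R.
Proof.
rewrite -!natrM; congr _%:R.
by have := bin_ffact n 2; rewrite factE/= => ->; rewrite ffactnS ffactn1.
Qed.

Lemma IAB_D_le c1 c2 a m W : (2 <= n)%N -> 0 <= a <= 1 -> 0 <= m <= 1 ->
  (forall i, ~ (c1 i i <-> c2 i i) -> i \in W) ->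
  (forall i j, c1 i i -> c1 j j -> c2 i i -> c2 j j ->
     ~ (c1 i j <-> c2 i j) -> i \in W \/ j \in W) ->
  IAB_D a m c1 c2 <= 2 * #|W|%:R / n%:R.
Proof.
move=> n2 /andP[a0 a1] /andP[m0 m1] h1 h2.
pose M : {set 'I_n} := [set i : 'I_n | `[< c1 i i /\ ~ c2 i i >]]%SET.
pose M' : {set 'I_n} := [set i : 'I_n | `[< ~ c1 i i /\ c2 i i >]]%SET.
pose W' : {set 'I_n} := [set i in W | `[< c1 i i /\ c2 i i >]]%SET.
have card_classical (p : pred 'I_n) : #|[set i | p i]%classic| = #|[set i | p i]%SET|.
  by apply: eq_card => i; rewrite finset.inE; apply/idP/idP => [/set_mem|/mem_set].
have n0 : 0 < n%:R :> R by rewrite ltr0n; apply: leq_trans n2.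
have n10 : 0 < (n.-1)%:R :> R by rewrite ltr0n -ltnS prednK//; apply: leq_trans n2.
have cardW : (#|M| + #|M'| + #|W'| <= #|W|)%N.
  have d1 : [disjoint M & M']%B.
    rewrite -finset.setI_eq0; apply/eqP/setP => i; rewrite !inE.
    by apply/negbTE/negP => /andP[/asboolP[? ?] /asboolP[]].
  have d2 : [disjoint (M :|: M')%SET & W']%B.
    rewrite -finset.setI_eq0; apply/eqP/setP => i; rewrite !inE.
    apply/negbTE/negP => /andP[/orP[]/asboolP[? ?] /andP[_ /asboolP[]]] //.
  have -> : (#|M| + #|M'| + #|W'| = #|(M :|: M' :|: W')%SET|)%N.
    rewrite finset.cardsU (_ : (_ :&: W')%SET = finset.set0) ?cards0 ?subn0; last first.
      by apply/eqP; rewrite finset.setI_eq0.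
    rewrite finset.cardsU (_ : (M :&: M')%SET = finset.set0) ?cards0 ?subn0//.
    by apply/eqP; rewrite finset.setI_eq0.
  apply: subset_leq_card; apply/fintype.subsetP => i; rewrite !inE.
  move=> /orP[/orP[]/asboolP[? ?]|/andP[]//]; by apply: h1; tauto.
rewrite /IAB_D ler_pdivrMr; last first.
  by rewrite -(pmulr_lgt0 _ (_ : 0 < 2 :> R))// bin2_natr mulr_gt0.
have -> : 2 * #|W|%:R / n%:R * 'C(n, 2)%:R = (n.-1)%:R * #|W|%:R :> R.
  have -> : 'C(n, 2)%:R = n%:R * (n.-1)%:R / 2 :> R by rewrite -bin2_natr mulfK.
  by field; rewrite gt_eqF.
rewrite /IAB_loss !card_classical -/M -/M'.
apply: (@le_trans _ _ ((n.-1)%:R * (#|M| + #|M'|)%:R + (n.-1)%:R * #|W'|%:R)).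
  apply: lerD.
    by rewrite ler_wpM2r// ler_piMr// ltW.
  rewrite -sum_lt_pairs; apply: ler_sum => i _.
  rewrite big_mkcondr/=; apply: ler_sum => j ij; case: asboolP => [[ci cj di dj]|_].
    have [/h2 h|/contrapT h] := pselect (~ (c1 i j <-> c2 i j)).
      apply: (@le_trans _ _ 1).
        rewrite -[leRHS]mul1r ler_pM// ?addr_ge0//.
        by case: asboolP => [[? ?]|_]; case: asboolP => [[? ?]|_] //=; rewrite ?addr0 ?add0r.
      rewrite -natrD ler1n addn_gt0; have [] := h ci cj di dj => hW.
        have -> // : i \in W' by rewrite finset.inE hW; exact/asboolP.
      rewrite orbC; have -> // : j \in W' by rewrite finset.inE hW; exact/asboolP.
    case: asboolP => [[/h ? ?]//|_]; case: asboolP => [[? /h ?]//|_].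
    by rewrite /= addr0 mulr0 addr_ge0.
  by rewrite addr_ge0.
by rewrite -mulrDr -natrD ler_wpM2l// ?ler_nat// ltW.
Qed.

End Loss.

Section Clusters.
Context {R : realType} {d n : nat}.
Context (f0 f : 'rV[R]_d -> R) (lam eps delta rho : R) (x : 'I_n -> 'rV[R]_d).
Hypothesis eps0 : 0 < eps.
Hypothesis f_close : forall y, `|f y - f0 y| <= eps.
Hypothesis delta_hmod : (delta%:E <= 2%:E * hmod f0 eps)%E.
Hypothesis rho0 : 0 < rho.
Hypothesis rho_delta : 2 * rho <= delta.

Lemma modulus_le u v : enorm (u - v) < delta / 2 -> `|f0 u - f0 v| <= eps.
Proof.
move=> uv.
have : ((enorm (u - v))%:E < hmod f0 eps)%E.
  apply: (@lt_le_trans _ _ (delta / 2)%:E); first by rewrite lte_fin.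
  by rewrite mulrC EFinM lee_pdivrMl.
move=> /ereal_sup_gt[_ [h [_ hh] <-]]; rewrite lte_fin => uvh.
by apply: hh; exact: ltW.
Qed.

Lemma psi_graph_refl i : psi_graph f lam delta x i i <-> lam <= f (x i).
Proof. by split => [[]//|h]; split => //; exact: rt_refl. Qed.

Lemma psi_true_refl i : psi_true f0 lam x i i <-> lam <= f0 (x i).
Proof.
split=> [/connected_component_sub//|h].
by rewrite /psi_true; exact: connected_component_refl.
Qed.

Lemma graph_edge_connected i j : lam <= f (x i) -> lam <= f (x j) ->
  enorm (x i - x j) < delta ->
  connected_component (Slev f0 (lam - 2 * eps)) (x i) (x j).
Proof.
move=> fi fj dij.
exists [set x i + t *: (x j - x i) | t in `[0, 1]%classic]; last first.
  by exists 1; rewrite /= ?in_itv/= ?ler01 ?lexx// scale1r subrKC.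
split; last exact: connected_segment.
  by exists 0; rewrite /= ?in_itv/= ?ler01 ?lexx// scale0r addr0.
move=> _ [t] /= + <-; rewrite in_itv/= => /andP[t0 t1]; rewrite /Slev/=.
have close k : lam <= f (x k) ->
    enorm (x i + t *: (x j - x i) - x k) < delta / 2 ->
    lam - 2 * eps <= f0 (x i + t *: (x j - x i)).
  move=> fk /modulus_le; have := f_close (x k).
  by rewrite !ler_distl => /andP[h1 h2] /andP[h3 h4]; lra.
have [t2|t2] := ltP t (1 / 2).
  apply: (close i) => //; rewrite addrC addKr enormZ ger0_norm// enorm_distC.
  apply: (@le_lt_trans _ _ (1 / 2 * enorm (x i - x j))).
    by rewrite ler_wpM2r ?enorm_ge0// ltW.
  lra.
apply: (close j) => //.
have -> : x i + t *: (x j - x i) - x j = (1 - t) *: (x i - x j).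
  by apply/rowP => k; rewrite !mxE; ring.
rewrite enormZ ger0_norm; last lra.
apply: (@le_lt_trans _ _ (1 / 2 * enorm (x i - x j))).
  by rewrite ler_wpM2r ?enorm_ge0//; lra.
lra.
Qed.

Lemma psi_graph_connected i j : psi_graph f lam delta x i j ->
  connected_component (Slev f0 (lam - 2 * eps)) (x i) (x j).
Proof.
move=> [fi ij].
suff : lam <= f (x i) -> lam <= f (x j) /\
    connected_component (Slev f0 (lam - 2 * eps)) (x i) (x j) by move=> /(_ fi)[].
elim: ij => {i j fi} [i j [fi fj dij]|i|i j k _ IHij _ IHjk] fi0.
- by split => //; exact: graph_edge_connected.
- split => //; apply: connected_component_refl; rewrite /Slev/=.
  by have := f_close (x i); rewrite ler_distl => /andP[h1 h2]; lra.
- have [fj cij] := IHij fi0; have [fk cjk] := IHjk fj.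
  by split => //; exact: connected_component_trans cjk.
Qed.

Hypothesis cover : forall z,
  (forall y, eball z rho y -> lam <= f0 y) -> exists i, eball z rho (x i).

Lemma connected_psi_graph i j :
  connected_component (Slev f0 (lam + 2 * eps)) (x i) (x j) ->
  psi_graph f lam delta x i j.
Proof.
move=> [K [Ki KS cK] Kj].
have near_K (z y : 'rV[R]_d) : K z -> eball z rho y -> lam + eps <= f0 y.
  move=> /KS zS zy; have : enorm (y - z) < delta / 2.
    by move: zy rho_delta; rewrite /eball/=; lra.
  by move=> /modulus_le; rewrite /Slev/= in zS; rewrite ler_distl => /andP[h1 h2]; lra.
have K_active (z : 'rV[R]_d) k : K z -> eball z rho (x k) -> lam <= f (x k).
  move=> Kz /(near_K _ _ Kz); have := f_close (x k).
  by rewrite ler_distl => /andP[h1 h2]; lra.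
have center z : eball z rho z by rewrite /eball/= subrr enorm0.
have fi : lam <= f (x i) by exact: (K_active (x i)).
have fj : lam <= f (x j) by exact: (K_active (x j)).
have extend k l : psi_graph f lam delta x i k -> lam <= f (x k) ->
    lam <= f (x l) -> enorm (x k - x l) < delta -> psi_graph f lam delta x i l.
  move=> [_ ik] fk fl kl; split => //; apply: rt_trans ik _.
  by apply: rt_step.
pose U := \bigcup_(k in [set k | psi_graph f lam delta x i k /\ lam <= f (x k)])
  eball (x k) rho.
pose V := \bigcup_(k in [set k | ~ psi_graph f lam delta x i k /\ lam <= f (x k)])
  eball (x k) rho.
have KUV (z : 'rV[R]_d) : K z -> U z \/ V z.
  move=> Kz; have [|k zk] := cover (z := z).
    by move=> y zy; apply: le_trans (near_K _ _ Kz zy); rewrite lerDl ltW.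
  have fk := K_active _ _ Kz zk.
  have kz : eball (x k) rho z by rewrite /eball/= enorm_distC.
  have [gk|gk] := pselect (psi_graph f lam delta x i k).
    by left; exists k.
  by right; exists k.
have UV (z : 'rV[R]_d) : U z -> V z -> False.
  move=> [k [gk fk] kz] [l [ngl fl] lz]; apply: ngl; apply: (extend k) => //.
  apply: le_lt_trans (ler_enorm_dist z _ _) _.
  by rewrite enorm_distC; move: kz lz rho_delta; rewrite /eball/=; lra.
have KU : K `&` U = K.
  apply: cK.
  - exists (x i); split => //; exists i; first by split => //; exact/psi_graph_refl.
    exact: center.
  - exists U => //; apply: bigcup_open => k _; exact: open_eball.
  - exists (~` V).
      by rewrite closedC; apply: bigcup_open => k _; exact: open_eball.
    apply/seteqP; split => z [Kz]; first by move=> Uz; split => // /(UV _ Uz).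
    by move=> nV; split => //; have [] := KUV z Kz.
have : U (x j) by move: Kj; rewrite -KU => -[].
move=> [k [gk fk] kj]; apply: (extend k) => //.
by rewrite enorm_distC; move: kj rho_delta rho0; rewrite /eball/=; lra.
Qed.

Variable epsbar : R.
Hypothesis eps_epsbar : 2 * eps < epsbar.
Hypothesis level_stable : forall lam_l lam_h : R,
  lam - epsbar <= lam_l -> lam_l < lam_h -> lam_h <= lam + epsbar ->
  forall y z, Slev f0 lam_h y -> Slev f0 lam_h z ->
    connected_component (Slev f0 lam_l) y z ->
    connected_component (Slev f0 lam_h) y z.

Lemma IAB_D_psi_le (a m : R) : (2 <= n)%N -> 0 <= a <= 1 -> 0 <= m <= 1 ->
  IAB_D a m (psi_graph f lam delta x) (psi_true f0 lam x) <=
  2 * #|[set i | `|f0 (x i) - lam| <= 2 * eps]%SET|%:R / n%:R.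
Proof.
move=> n2 a01 m01; have e0 := eps0; have e1 := eps_epsbar.
apply: IAB_D_le => //.
  move=> i; rewrite inE; apply: contra_notT; rewrite -ltNge => h.
  rewrite psi_graph_refl psi_true_refl; have := f_close (x i); move: h.
  by rewrite ltr_normr ler_distl => /orP[h|h] /andP[h1 h2]; split => ?; lra.
move=> i j; rewrite !psi_graph_refl !psi_true_refl => fi fj f0i f0j.
rewrite !inE => ne; apply/orP; move: ne; apply: contra_notT.
rewrite negb_or -!ltNge !ger0_norm ?subr_ge0// => /andP[hi hj].
split=> [/psi_graph_connected|] c.
  by apply: level_stable c => //; lra.
apply: connected_psi_graph; apply: level_stable c; rewrite /Slev/=; lra.
Qed.

End Clusters.

Section Packing.
Context {R : realType} {d : nat}.

Definition separated_seq (s : R) (L : seq 'rV[R]_d) : bool :=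
  pairwise (fun y z => s <= enorm (y - z)) L.

Lemma maximal_separated_seq (Z : set 'rV[R]_d) (s : R) (N : nat) :
  (forall L, (forall y, y \in L -> Z y) -> separated_seq s L -> (size L <= N)%N) ->
  exists L, [/\ forall y, y \in L -> Z y, separated_seq s L &
    forall z, Z z -> exists2 y, y \in L & enorm (z - y) < s].
Proof.
move=> bounded.
pose Q k := `[< exists L, [/\ size L = k, forall y, y \in L -> Z y &
  separated_seq s L] >].
have Q0 : exists k, Q k by exists 0%N; apply/asboolP; exists [::].
have QN k : Q k -> (k <= N)%N by move=> /asboolP[L [<- ZL sL]]; exact: bounded.
case: (ex_maxnP Q0 QN) => k /asboolP[L [<- ZL sL]] maxL.
exists L; split => // z Zz; apply: contrapT => noL.
suff /maxL : Q (size L).+1 by rewrite ltnn.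
apply/asboolP; exists (z :: L); split => //.
  by move=> y; rewrite inE => /predU1P[->//|]; exact: ZL.
rewrite /separated_seq /=; apply/andP; split => //; apply/allP => y yL.
by rewrite leNgt; apply/negP => zy; apply: noL; exists y.
Qed.

Context {dO : measure_display} {Omega : measurableType dO}.
Variables (P : probability Omega R) (Y : Omega -> Rd R d).
Hypothesis mY : measurable_fun [set: Omega] Y.

Lemma measurable_eball_preimage (y : 'rV[R]_d) r : measurable (Y @^-1` eball y r).
Proof.
rewrite -[X in measurable X]setTI; apply: mY => //.
by apply: open_borel; exact: open_eball.
Qed.

Lemma size_separated_seq (s q : R) (L : seq 'rV[R]_d) :
  (forall y, y \in L -> (q%:E <= P (Y @^-1` eball y (s / 2)))%E) ->
  separated_seq s L -> (size L)%:R * q <= 1.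
Proof.
move=> massL sepL.
pose F k := Y @^-1` eball (nth 0 L k) (s / 2).
have mF k : measurable (F k) by exact: measurable_eball_preimage.
have tF : trivIset `I_(size L) F.
  apply/trivIsetP => i j /= iL jL.
  wlog ij : i j iL jL / (i < j)%N.
    move=> h; rewrite neq_ltn => /orP[] ij; last rewrite setIC;
      by apply: h => //; rewrite ?(ltn_eqF ij)// neq_ltn ij.
  move=> _; apply/seteqP; split => // w [].
  rewrite /F /preimage /eball /= => hi hj.
  have /(pairwiseP 0)/(_ i j) := sepL; rewrite !inE => /(_ iL jL ij).
  have := ler_enorm_dist (Y w) (nth 0 L i) (nth 0 L j).
  rewrite (enorm_distC (nth 0 L i) (Y w)) => h1 h2.
  by move: hi hj h1 h2; lra.
rewrite -lee_fin; apply: (@le_trans _ _ (P (\big[setU/set0]_(k < size L) F k))).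
  rewrite measure_semi_additive_ord_I//; last first.
    by apply: bigsetU_measurable => k _.
  apply: (@le_trans _ _ (\sum_(k < size L) q%:E)%E).
    by rewrite sumEFin sumr_const card_ord mulr_natl.
  by apply: lee_sum => k _; apply: massL; exact: mem_nth.
by apply: probability_le1; apply: bigsetU_measurable => k _.
Qed.

End Packing.

Lemma bernoulli_ineq (R : realType) (x : R) k : 0 <= x <= 1 ->
  1 - k%:R * x <= (1 - x) ^+ k.
Proof.
move=> /andP[x0 x1]; elim: k => [|k IH]; first by rewrite mul0r subr0 expr0.
rewrite exprS -natr1; apply: (@le_trans _ _ ((1 - x) * (1 - k%:R * x))).
  have : 0 <= k%:R * x * x by rewrite !mulr_ge0.
  lra.
by rewrite ler_wpM2l// subr_ge0.
Qed.

Section NaturalLog.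
Context {R : realType} (n : nat).
Hypothesis n16 : (16 <= n)%N.

Lemma natr_ge16 : 16 <= n%:R :> R.
Proof. by rewrite (ler_nat R 16). Qed.

Lemma ln_nat_ge1 : 1 <= ln n%:R :> R.
Proof.
have n0 := natr_ge16; rewrite -ler_expR lnK ?posrE; last lra.
by apply: le_trans (expR1_le3 R) _; lra.
Qed.

Lemma expR_ln_nat k : expR (ln n%:R *+ k) = n%:R ^+ k :> R.
Proof.
have n0 := natr_ge16.
by rewrite -[ln n%:R *+ k]mulr_natl expRM_natl lnK// posrE; lra.
Qed.

Lemma ln_nat_le : ln n%:R <= n%:R :> R.
Proof.
have := expR_ge1Dx (ln n%:R : R); have := expR_ln_nat 1.
by rewrite mulr1n expr1 => ->; lra.
Qed.

Lemma ln_le_sqrt_dev : ln n%:R <= n%:R * Num.sqrt (ln n%:R / n%:R) :> R.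
Proof.
have n0 := natr_ge16; have l1 := ln_nat_ge1; have ln_n := ln_nat_le.
have np : 0 < n%:R :> R by lra.
rewrite -(ler_pXn2r (_ : 0 < 2)%N)// ?nnegrE ?mulr_ge0 ?sqrtr_ge0//; try lra.
rewrite exprMn sqr_sqrtr; last by rewrite divr_ge0//; lra.
rewrite [leRHS](_ : _ = ln n%:R * n%:R); last by field; rewrite gt_eqF.
by rewrite expr2 ler_wpM2l//; lra.
Qed.

End NaturalLog.

Section CoverEvent.
Context {R : realType} {d n : nat} (leb : {measure set (Rd R d) -> \bar R}).
Context (lam : R) (f0 : 'rV[R]_d -> R).
Context {dO : measure_display} {Omega : measurableType dO}
  (P : probability Omega R) (X : 'I_n -> Omega -> Rd R d).
Hypothesis d0 : (0 < d)%N.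
Hypothesis hleb : is_lebesgue leb.
Hypothesis lam0 : 0 < lam.
Hypothesis mf0 : measurable_fun [set: Rd R d] f0.
Hypothesis mX : forall i, measurable_fun [set: Omega] (X i).
Hypothesis lawX : forall i (B : set (Rd R d)), measurable B ->
  P (X i @^-1` B) = (\int[leb]_(x in B) (f0 x)%:E)%E.
Hypothesis indepX : forall B : 'I_n -> set (Rd R d), (forall i, measurable (B i)) ->
  P (\bigcap_(i in [set: 'I_n]) (X i @^-1` B i)) =
  (\prod_(i < n) P (X i @^-1` B i))%E.
Hypothesis n16 : (16 <= n)%N.

Let v := vol_unit_ball leb.
Let rho := powR (16 * d%:R * ln n%:R / (lam * v * n%:R)) (d%:R^-1).

Lemma prob_eball_ge i z r : 0 < r -> (forall y, eball z r y -> lam <= f0 y) ->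
  ((lam * v * r ^+ d)%:E <= P (X i @^-1` eball z r))%E.
Proof.
move=> r0 zr.
have mB : measurable (eball z r : set (Rd R d)) by exact: measurable_eball.
rewrite lawX//.
have -> : (lam * v * r ^+ d)%:E = (\int[leb]_(x in eball z r) (cst lam%:E) x)%E.
  rewrite integral_cst// lebesgue_eball// -vol_unit_ballE// -!EFinM.
  by congr _%:E; rewrite /v; ring.
apply: ge0_le_integral => //.
- by move=> x _; rewrite lee_fin ltW.
- by apply/measurable_realfun.measurable_EFinP; exact: measurable_funTS.
Qed.

Lemma rho_gt0 : 0 < rho.
Proof.
have n0 := natr_ge16 (R := R) n16; have l1 := ln_nat_ge1 (R := R) n16.
have v0 : 0 < v by exact: vol_unit_ball_gt0.
have dp : 0 < d%:R :> R by rewrite ltr0n.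
have np : 0 < n%:R :> R by lra.
have lp : 0 < ln n%:R :> R by lra.
by apply: powR_gt0; rewrite divr_gt0 ?mulr_gt0.
Qed.

Lemma mass_rho : lam * v * rho ^+ d = 16 * d%:R * ln n%:R / n%:R.
Proof.
have n0 := natr_ge16 (R := R) n16; have l1 := ln_nat_ge1 (R := R) n16.
have dp : 0 < d%:R :> R by rewrite ltr0n.
have v0 : 0 < v by exact: vol_unit_ball_gt0.
rewrite -powR_mulrn ?powR_ge0// /rho -powRrM mulVf ?gt_eqF// powRr1; last first.
  have l0 : 0 <= ln n%:R :> R by lra.
  have [lam_ge0 v_ge0] := (ltW lam0, ltW v0).
  by rewrite divr_ge0// !mulr_ge0.
by field; rewrite !gt_eqF//; lra.
Qed.

Let q : R := 16 * d%:R * ln n%:R / n%:R.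
Let sep : R := rho / (2 * d%:R).
Let Z : set 'rV[R]_d := [set z | forall y, eball z rho y -> lam <= f0 y].

Lemma mass_le1 z : Z z -> q <= 1.
Proof.
move=> Zz; have n0 : (0 < n)%N by apply: leq_trans n16.
have := prob_eball_ge (Ordinal n0) rho_gt0 Zz.
rewrite mass_rho -lee_fin => /le_trans; apply; apply: probability_le1.
by apply: measurable_eball_preimage.
Qed.

Lemma size_packing_le (L : seq 'rV[R]_d) : (forall y, y \in L -> Z y) ->
  separated_seq sep L -> (size L <= n ^ d.+1)%N.
Proof.
case: L => [//|y0 L0]; set L := y0 :: L0 => ZL sL.
have n0 := natr_ge16 (R := R) n16; have l1 := ln_nat_ge1 (R := R) n16.
have d1 : 1 <= d%:R :> R by rewrite ler1n.
have rho0 := rho_gt0.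
have q1 : q <= 1 by apply: (@mass_le1 y0); apply: ZL; rewrite mem_head.
have dl : d%:R <= d%:R * ln n%:R :> R by rewrite ler_peMr.
have q_n : 16 * d%:R * ln n%:R <= n%:R :> R.
  by move: q1; rewrite /q ler_pdivrMr ?mul1r//; lra.
have d4 : 4 * d%:R <= n%:R :> R by lra.
have i0 : 'I_n by apply: (@Ordinal _ 0); apply: leq_trans n16.
have sz : (size L)%:R * (q / (4 * d%:R) ^+ d) <= 1.
  apply: (size_separated_seq (mX i0) (s := sep)) => // y yL.
  have e2 : sep / 2 = rho / (4 * d%:R) by rewrite /sep; field; rewrite gt_eqF//; lra.
  have s0 : 0 < sep / 2 by rewrite e2 divr_gt0//; lra.
  have sr : sep / 2 <= rho.
    by rewrite e2 ler_pdivrMr; [rewrite ler_peMr ?ltW//; lra|lra].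
  have -> : q / (4 * d%:R) ^+ d = lam * v * (sep / 2) ^+ d.
    by rewrite e2 expr_div_n mulrA mass_rho.
  apply: prob_eball_ge => // u yu; apply: (ZL y yL).
  by apply: lt_le_trans yu _.
rewrite -(ler_nat R) natrX exprS.
have dn : (4 * d%:R) ^+ d <= n%:R ^+ d :> R.
  by rewrite lerXn2r ?nnegrE//; lra.
have dd0 : 0 < (4 * d%:R) ^+ d :> R by rewrite exprn_gt0//; lra.
have q0 : 0 < q by rewrite /q !(divr_gt0, mulr_gt0)//; lra.
have nq : 1 <= n%:R * q by rewrite /q mulrC divfK ?gt_eqF; lra.
apply: (@le_trans _ _ (n%:R * (4 * d%:R) ^+ d)); last by rewrite ler_wpM2l.
move: sz; rewrite mulrA ler_pdivrMr// mul1r => sz.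
apply: (@le_trans _ _ ((size L)%:R * (n%:R * q))).
  by rewrite ler_peMr.
by rewrite mulrCA ler_wpM2l.
Qed.

Lemma prob_no_hit_eball z : Z z ->
  (P [set w | hits X (eball z (rho - sep)) w = finset.set0] <=
   (n%:R ^- (8 * d))%:E)%E.
Proof.
move=> Zz; have q1 := mass_le1 Zz.
have n0 := natr_ge16 (R := R) n16; have l1 := ln_nat_ge1 (R := R) n16.
have d1 : 1 <= d%:R :> R by rewrite ler1n.
have rho0 := rho_gt0.
pose x : R := (2 * d%:R)^-1.
have x01 : 0 <= x <= 1.
  by rewrite invr_ge0 invf_le1; lra.
have dx : d%:R * x = 1 / 2 by rewrite /x; field; rewrite gt_eqF//; lra.
have rs : rho - sep = rho * (1 - x) by rewrite /sep /x; ring.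
have x1 : x < 1 by rewrite invf_lt1; lra.
have rs0 : 0 < rho - sep by rewrite rs mulr_gt0// subr_gt0.
have sep0 : 0 <= sep by rewrite /sep divr_ge0//; lra.
have zsub y : eball z (rho - sep) y -> lam <= f0 y.
  move=> zy; apply: Zz; apply: lt_le_trans zy _; lra.
have B i : (((q / 2)%:E) <= P (X i @^-1` eball z (rho - sep)))%E.
  apply: le_trans (prob_eball_ge i rs0 zsub).
  rewrite lee_fin rs exprMn mulrA mass_rho -/q ler_wpM2l//.
    by rewrite /q !(divr_ge0, mulr_ge0)//; lra.
  by apply: le_trans (bernoulli_ineq _ x01); rewrite dx; lra.
have mB : measurable (eball z (rho - sep) : set (Rd R d)).
  exact: measurable_eball.
have i0 : 'I_n by apply: (@Ordinal _ 0); apply: leq_trans n16.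
pose p := fine (P (X i0 @^-1` eball z (rho - sep))).
have pE i : P (X i @^-1` eball z (rho - sep)) = p%:E.
  rewrite /p fineK ?lawX// -(lawX i0)//; apply: fin_num_measure.
  exact: measurable_sample_preimage.
have p1 : p <= 1.
  by rewrite -lee_fin -(pE i0); apply: probability_le1; exact: measurable_sample_preimage.
have qp : q / 2 <= p by rewrite -lee_fin -(pE i0).
rewrite (prob_no_hit mX indepX mB pE) lee_fin.
apply: (@le_trans _ _ (expR (- p) ^+ n)).
  by rewrite lerXn2r ?nnegrE ?expR_ge0 ?subr_ge0//; exact: expR_ge1Dx.
rewrite -expRM_natl -(expR_ln_nat n16) -expRN ler_expR mulrN lerN2.
rewrite -[leLHS]mulr_natl natrM.
apply: (@le_trans _ _ (n%:R * (q / 2))); last by rewrite ler_wpM2l.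
rewrite /q le_eqVlt; apply/orP; left; apply/eqP; field.
by rewrite gt_eqF//; lra.
Qed.

Lemma cover_event : exists G : set Omega, [/\ measurable G,
  (P (~` G) <= (n%:R ^- 2)%:E)%E &
  forall w, G w -> forall z, (forall y, eball z rho y -> lam <= f0 y) ->
    exists i, eball z rho (X i w)].
Proof.
have [L [ZL sL covL]] := maximal_separated_seq size_packing_le.
pose bad y := [set w | hits X (eball y (rho - sep)) w = finset.set0].
have mB y : measurable (eball y (rho - sep) : set (Rd R d)).
  exact: measurable_eball.
have mbad y : measurable (bad y).
  by rewrite /bad -hit_patternE; exact: measurable_hit_pattern.
exists (~` \big[setU/set0]_(y <- L) bad y); split.
- by apply: measurableC; apply: bigsetU_measurable => y _.
- rewrite setCK; apply: (@le_trans _ _ (\sum_(y <- L) P (bad y))%E).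
    exact: measure_bigsetU_le.
  apply: (@le_trans _ _ (\sum_(y <- L) (n%:R ^- (8 * d))%:E)%E).
    rewrite [leLHS]big_seq [leRHS]big_seq; apply: lee_sum => y yL.
    by apply: prob_no_hit_eball; exact: ZL.
  rewrite sumEFin lee_fin big_const_seq iter_addr addr0 count_predT -[leLHS]mulr_natl.
  have n0 : (0 < n)%N by apply: leq_trans n16.
  rewrite ler_pdivrMr ?exprn_gt0 ?ltr0n// mulrC ler_pdivlMr ?exprn_gt0 ?ltr0n//.
  rewrite -!natrX -natrM ler_nat.
  apply: (@leq_trans (n ^ d.+1 * n ^ 2)); first by rewrite leq_mul2r size_packing_le// orbT.
  by rewrite -expnD leq_pexp2l//; lia.
- move=> w Gw z /covL[y yL zy].
  have : ~ bad y w.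
    by move=> by_; apply: Gw; rewrite -bigcup_seq; exists y.
  move=> /eqP/set0Pn[i]; rewrite finset.inE => /asboolP yi; exists i.
  apply: le_lt_trans (ler_enorm_dist y _ _) _.
  by move: yi; rewrite /eball/= (enorm_distC y z); move: zy; lra.
Qed.

End CoverEvent.

Lemma lt_shrink (R : realType) (u t : R) : 0 < u -> t < u ->
  exists k : nat, t <= u * (1 - k.+2%:R^-1).
Proof.
move=> u0 tu; have ut : 0 < u - t by rewrite subr_gt0.
exists (Num.truncn (u / (u - t))).
set k := Num.truncn _.
have : u / (u - t) < k.+2%:R.
  by apply: lt_trans (truncnS_gt _) _; rewrite ltr_nat.
rewrite ltr_pdivrMr// => hk.
have : u * k.+2%:R^-1 < u - t by rewrite ltr_pdivrMr ?ltr0n// mulrC.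
by move=> /ltW; rewrite mulrBr mulr1 !lerBrDr addrC.
Qed.

Section BandEvent.
Context {R : realType} {d n : nat} (leb : {measure set (Rd R d) -> \bar R}).
Context (lam C epsbar : R) (f0 : 'rV[R]_d -> R).
Context {dO : measure_display} {Omega : measurableType dO}
  (P : probability Omega R) (X : 'I_n -> Omega -> Rd R d).
Hypothesis cf0 : continuous f0.
Hypothesis C0 : 0 < C.
Hypothesis band_mass : forall eps : R, 0 < eps < epsbar ->
  (\int[leb]_(x in [set x : Rd R d | (`|f0 x - lam| <= eps)%R]) (f0 x)%:E
   <= (C * eps)%:E)%E.
Hypothesis mX : forall i, measurable_fun [set: Omega] (X i).
Hypothesis lawX : forall i (B : set (Rd R d)), measurable B ->
  P (X i @^-1` B) = (\int[leb]_(x in B) (f0 x)%:E)%E.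
Hypothesis indepX : forall B : 'I_n -> set (Rd R d), (forall i, measurable (B i)) ->
  P (\bigcap_(i in [set: 'I_n]) (X i @^-1` B i)) =
  (\prod_(i < n) P (X i @^-1` B i))%E.
Hypothesis n16 : (16 <= n)%N.

Let cdist : continuous (fun x : 'rV[R]_d => `|f0 x - lam|).
Proof.
move=> x; apply: (@continuous_comp _ _ _ (fun x => f0 x - lam) Num.norm).
  by apply: (@continuousB _ _ _ f0 (cst lam)) => //; [exact: cf0|exact: cst_continuous].
exact: norm_continuous.
Qed.

Let oband (u : R) : set (Rd R d) := [set x : Rd R d | `|f0 x - lam| < u].
Let cband (u : R) : set (Rd R d) := [set x : Rd R d | `|f0 x - lam| <= u].

Let measurable_oband u : measurable (oband u).
Proof.
apply: open_borel; apply: (@open_comp _ _ _ [set t : R | t < u]); last exact: open_lt.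
by move=> x _; exact: cdist.
Qed.

Let measurable_cband u : measurable (cband u).
Proof.
rewrite -(setCK (cband u)); apply: measurableC; apply: open_borel.
have -> : ~` cband u = (fun x : 'rV[R]_d => `|f0 x - lam|) @^-1` [set t : R | u < t].
  by apply/seteqP; split => x /=; rewrite /cband/= ltNge => /negP.
by apply: open_comp; [move=> x _; exact: cdist|exact: open_gt].
Qed.

(* The mass assumption concerns closed bands of width < epsbar; exhausting an
   open band by such bands includes the width epsbar itself. *)
Lemma prob_open_band_le i (u : R) : 0 < u <= epsbar ->
  (P (X i @^-1` oband u) <= (C * u)%:E)%E.
Proof.
move=> /andP[u0 ue].
pose r k : R := u * (1 - k.+2%:R^-1).
have r_lt k : r k < u by rewrite /r gtr_pMr// gtrBl invr_gt0.
have r_gt0 k : 0 < r k.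
  by rewrite /r mulr_gt0// subr_gt0 invf_lt1 ?ltr0n// ltr1n.
pose F k := X i @^-1` cband (r k).
have mF k : measurable (F k) by exact: measurable_sample_preimage.
have UF : X i @^-1` oband u = \bigcup_k F k.
  apply/seteqP; split => w; rewrite /F /preimage /oband /cband /=.
    by move=> /(lt_shrink u0)[k hk]; exists k.
  by move=> [k _] /=; move=> /le_lt_trans; apply.
have nd : nondecreasing_seq F.
  move=> k l kl; apply/subsetPset => w; rewrite /F /preimage /cband /=.
  move=> /le_trans; apply; rewrite /r ler_pM2l// lerD2l lerN2.
  by rewrite lef_pV2 ?posrE ?ltr0n// ler_nat.
rewrite UF.
have /cvge_to_le := nondecreasing_cvg_mu (mu := P) mF (bigcup_measurable (fun k _ => mF k)) nd.
apply; apply: nearW => k /=; rewrite /F lawX//.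
apply: le_trans (band_mass _) _; first by rewrite r_gt0 (lt_le_trans (r_lt k)).
by rewrite lee_fin ler_pM2l// ltW.
Qed.

Let dev : R := Num.sqrt (ln n%:R / n%:R).

(* Rounding t up to the grid of widths k/(nC), 1 <= k <= n, increases C * t by at
   most 1/n; beyond the grid C * t >= 1. *)
Lemma band_event : exists G : set Omega, [/\ measurable G,
  (P (~` G) <= (n%:R^-1)%:E)%E &
  forall w, G w -> forall t, 0 < t < epsbar ->
    #|[set i | `|f0 (X i w) - lam| <= t]%SET|%:R <= n%:R * (2 * C * t + 4 * dev)].
Proof.
have n0 := natr_ge16 (R := R) n16; have l1 := ln_nat_ge1 (R := R) n16.
have ln_dev := ln_le_sqrt_dev (R := R) n16; rewrite -/dev in ln_dev.
have np : 0 < n%:R :> R by lra.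
have nC : 0 < n%:R * C by rewrite mulr_gt0.
have dev0 : 0 <= dev by exact: sqrtr_ge0.
have [eb0|eb0] := leP epsbar 0.
  exists setT; split => //.
    by rewrite setCT measure0 lee_fin invr_ge0 ltW.
  by move=> w _ t /andP[t0 te]; lra.
pose u (k : 'I_n) := Num.min (k.+1%:R / (n%:R * C)) epsbar.
pose thr (k : 'I_n) : R := 2 * k.+1%:R + 2 * (n%:R * dev).
pose bad k := [set w | thr k < #|hits X (oband (u k)) w|%:R].
have i0 : 'I_n by apply: (@Ordinal _ 0); apply: leq_trans n16.
have badP k : measurable (bad k) /\ (P (bad k) <= (n%:R ^- 2)%:E)%E.
  have u0 : 0 < u k by rewrite lt_min eb0 divr_gt0// ltr0n.
  pose p := fine (P (X i0 @^-1` oband (u k))).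
  have pE i : P (X i @^-1` oband (u k)) = p%:E.
    rewrite /p fineK ?lawX// -(lawX i0)//; apply: fin_num_measure.
    exact: measurable_sample_preimage.
  have p01 : 0 <= p <= 1.
    rewrite -!lee_fin -(pE i0); apply/andP; split => //; apply: probability_le1.
    exact: measurable_sample_preimage.
  have pk : n%:R * p <= k.+1%:R.
    have := @prob_open_band_le i0 (u k); rewrite u0 ge_min lexx orbT => /(_ isT).
    rewrite pE lee_fin => pu.
    apply: (@le_trans _ _ (n%:R * (C * u k))); first by rewrite ler_wpM2l.
    rewrite mulrA; apply: (@le_trans _ _ (n%:R * C * (k.+1%:R / (n%:R * C)))).
      by rewrite ler_pM2l// /u ge_min lexx.
    by rewrite mulrC divfK// gt_eqF.
  have [mbad Pbad] := prob_hits_gt mX indepX (measurable_oband (u k)) pE p01 (thr k).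
  split=> //; apply: le_trans Pbad _; rewrite lee_fin.
  rewrite -(expR_ln_nat n16) -expRN ler_expR /thr mulr2n; lra.
exists (~` \big[setU/set0]_(k < n) bad k).
have mU : measurable (\big[setU/set0]_(k < n) bad k).
  by apply: bigsetU_measurable => k _; have [] := badP k.
split; first exact: measurableC.
  rewrite setCK; apply: (@le_trans _ _ (\sum_(k < n) P (bad k))%E).
    by apply: measure_bigsetU_le => k; have [] := badP k.
  apply: (@le_trans _ _ (\sum_(k < n) (n%:R ^- 2)%:E)%E).
    by apply: lee_sum => k _; have [] := badP k.
  rewrite sumEFin lee_fin sumr_const card_ord -[leLHS]mulr_natl expr2 invfM.
  by rewrite mulVKf// gt_eqF.
move=> w Gw t /andP[t0 te].
set A := [set i | _]%SET.
have [Ct1|Ct1] := leP 1 (C * t).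
  apply: (@le_trans _ _ (n%:R * 1)).
    by rewrite mulr1 ler_nat -[leqRHS]card_ord max_card.
  by rewrite ler_pM2l//; lra.
have nCt0 : 0 <= n%:R * C * t by rewrite mulr_ge0// ltW.
have /andP[k_le k_gt] := truncn_itv nCt0.
set k := Num.truncn _ in k_le k_gt.
have kn : (k < n)%N.
  rewrite -(ltr_nat R); apply: le_lt_trans k_le _.
  by rewrite -mulrA -[ltRHS]mulr1 ltr_pM2l.
pose K := Ordinal kn.
have AK : A \subset hits X (oband (u K)) w.
  apply/fintype.subsetP => i; rewrite !finset.inE => h; apply/asboolP.
  rewrite /oband/=; apply: le_lt_trans h _.
  by rewrite /u lt_min te andbT ltr_pdivlMr// mulrC.
have hK : #|hits X (oband (u K)) w|%:R <= thr K.
  rewrite leNgt; apply/negP => h; apply: Gw; rewrite -bigcup_seq.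
  by exists K => //=; rewrite mem_index_enum.
apply: (@le_trans _ _ (#|hits X (oband (u K)) w|%:R)).
  by rewrite ler_nat subset_leq_card.
apply: le_trans hK _; rewrite /thr /= -natr1.
have := ln_dev; move: k_le; lra.
Qed.

End BandEvent.

Unset Implicit Arguments. Set Strict Implicit. Set Printing Implicit Defensive.

Theorem theoremS1
  (R : realType) (d : nat) (leb : {measure set (Rd R d) -> \bar R})
  (lam : R) (f0 : 'rV[R]_d -> R) (C epsbar : R)
  (dO : measure_display) (Omega : measurableType dO) (P : probability Omega R)
  (n : nat) (X : 'I_n -> Omega -> Rd R d) (a m : R) :
  (0 < d)%N ->
  is_lebesgue leb ->
  0 < lam ->
  (* f0 is a probability density w.r.t. Lebesgue measure on R^d *)
  (forall x, 0 <= f0 x) ->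
  measurable_fun [set: Rd R d] f0 ->
  (\int[leb]_(x in [set: Rd R d]) (f0 x)%:E = 1)%E ->
  (* (i) *)
  continuous f0 ->
  (forall e : R, 0 < e -> exists M : R, forall x, M < enorm x -> `|f0 x| < e) ->
  (* (ii) *)
  0 < C -> 0 < epsbar ->
  (forall eps : R, 0 < eps < epsbar ->
     (\int[leb]_(x in [set x : Rd R d | (`|f0 x - lam| <= eps)%R]) (f0 x)%:E
        <= (C * eps)%:E)%E) ->
  (* (iii) *)
  (forall lam_l lam_h : R,
     lam - epsbar <= lam_l -> lam_l < lam_h -> lam_h <= lam + epsbar ->
     forall x y : 'rV[R]_d, Slev f0 lam_h x -> Slev f0 lam_h y ->
       (~ connected_component (Slev f0 lam_h) x y ->
          ~ connected_component (Slev f0 lam_l) x y) /\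
       (connected_component (Slev f0 lam_l) x y ->
          connected_component (Slev f0 lam_h) x y)) ->
  (* X_1, ..., X_n i.i.d. with density f0 *)
  (forall i, measurable_fun [set: Omega] (X i)) ->
  (forall i (B : set (Rd R d)), measurable B ->
     P (X i @^-1` B) = (\int[leb]_(x in B) (f0 x)%:E)%E) ->
  (forall B : 'I_n -> set (Rd R d), (forall i, measurable (B i)) ->
     P (\bigcap_(i in [set: 'I_n]) (X i @^-1` B i))
     = (\prod_(i < n) P (X i @^-1` B i))%E) ->
  (16 <= n)%N ->
  0 < a -> a <= 1 -> 0 < m -> m <= 1 -> a <= 2 * m ->
  exists A : set Omega, [/\ measurable A,
    (A `<=` [set w | forall eps : R, 0 < eps < epsbar / 2 ->
       forall delta : R,
         rnld d n lam (vol_unit_ball leb) <= delta ->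
         (delta%:E <= 2%:E * hmod f0 eps)%E ->
         forall f : 'rV[R]_d -> R, (forall x, `|f x - f0 x| <= eps) ->
           IAB_D a m (psi_graph f lam delta (fun i => X i w))
                     (psi_true f0 lam (fun i => X i w))
           <= 8 * (C * eps + Num.sqrt (ln n%:R / n%:R))])
    & ((1 - (n.+1)%:R / (n ^ 2)%:R)%:E <= P A)%E].
Proof.
  (* your proof *)
Proof.
move=> d0 hleb lam0 _ mf0 _ cf0 _ C0 epsbar0 band level mX lawX indepX n16
  a0 a1 m0 m1 _.
have n0 := natr_ge16 (R := R) n16.
have [G1 [mG1 PG1 cover]] :=
  cover_event d0 hleb lam0 mf0 mX lawX indepX n16.
have [G2 [mG2 PG2 few]] := band_event cf0 C0 band mX lawX indepX n16.
exists (G1 `&` G2); split; first exact: measurableI.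
- move=> w [G1w G2w] eps /andP[eps0 eps_half] delta rdelta delta_h f ff0.
  have e2 : 2 * eps < epsbar by lra.
  have lvl lam_l lam_h : lam - epsbar <= lam_l -> lam_l < lam_h ->
      lam_h <= lam + epsbar ->
      forall y z, Slev f0 lam_h y -> Slev f0 lam_h z ->
      connected_component (Slev f0 lam_l) y z ->
      connected_component (Slev f0 lam_h) y z.
    by move=> h1 h2 h3 y z hy hz; have [] := level _ _ h1 h2 h3 y z hy hz.
  apply: le_trans (IAB_D_psi_le eps0 ff0 delta_h
    (rho_gt0 d0 hleb lam0 n16) rdelta (cover w G1w) e2 lvl _ _ _) _.
  + exact: leq_trans n16.
  + by rewrite (ltW a0).
  + by rewrite (ltW m0).
  have t_lt : 0 < 2 * eps < epsbar by rewrite mulr_gt0.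
  have := few w G2w (2 * eps) t_lt.
  rewrite ler_pdivrMr; last lra.
  lra.
- have mG : measurable (G1 `&` G2) by exact: measurableI.
  have bad_le : (P (~` (G1 `&` G2)) <= (n.+1%:R / (n ^ 2)%:R)%:E)%E.
    rewrite setCI; apply: (@le_trans _ _ (P (~` G1) + P (~` G2))%E).
      by apply: measureU2; exact: measurableC.
    apply: le_trans (leeD PG1 PG2) _.
    rewrite -EFinD lee_fin le_eqVlt; apply/orP; left; apply/eqP.
    by rewrite natrX -natr1; field; rewrite gt_eqF//; lra.
  rewrite -(setCK (G1 `&` G2)) probability_setC; last exact: measurableC.
  by rewrite EFinB leeB.
Qed.
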